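(* Let $n=2m$ with $m\ge3$, and let $\alpha_1,\dots,\alpha_{m-2}\in\mathbb C$. Let $C_n(\alpha_1,\dots,\alpha_{m-2})$ be the complex Lie algebra with basis $\{Y_0,Y_1,\dots,Y_{n-1}\}$ and brackets $$ \begin{array}{ll} [Y_0,Y_i]=Y_{i+1}, & 1\le i\le n-3,\\ {}[Y_i,Y_{n-i-1}]=(-1)^iY_{n-1}, & 1\le i\le m-1,\\ {}[Y_i,Y_{n-(2k+1)-i}]=(-1)^{i+1}\alpha_kY_{n-1}, & 1\le i\le m-k-1,\ 1\le k\le m-2, \end{array} $$ all unlisted brackets being zero except those obtained by antisymmetry. Then $C_n(\alpha_1,\dots,\alpha_{m-2})$ is isomorphic to $Q_n$, and consequently it has rank $2$ (and not rank $1$).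
   Context: $Q_n$ ($n=2m$, $m\ge3$) is the complex Lie algebra with basis $\{X_0,\dots,X_{n-1}\}$ and brackets $[X_0,X_i]=X_{i+1}$ for $1\le i\le n-3$, $[X_j,X_{n-j-1}]=(-1)^{j-1}X_{n-1}$ for $1\le j\le m-1$ (unlisted brackets are zero, up to antisymmetry). The rank of a Lie algebra $\mathfrak g$ is the common dimension of its maximal tori of derivations, i.e. of the maximal abelian subalgebras of $\mathrm{Der}(\mathfrak g)$ consisting of diagonalizable derivations. *)

(* Defs.v *)
From HB Require Import structures.
From mathcomp Require Import all_boot all_order all_algebra.
From mathcomp Require Import zify ring.
From mathcomp Require Import reals complex.

Set Implicit Arguments.
Unset Strict Implicit.
Unset Printing Implicit Defensive.

Import GRing.Theory.
Local Open Scope ring_scope.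

HB.mixin Record Vector_isLieAlgebra (K : fieldType) L of Vector K L := {
  lie : L -> L -> L;
  lieDl : forall (a : K) (x y z : L), lie (a *: x + y) z = a *: lie x z + lie y z;
  lieDr : forall (a : K) (x y z : L), lie z (a *: x + y) = a *: lie z x + lie z y;
  liexx : forall x : L, lie x x = 0;
  lieJ : forall x y z : L,
    lie x (lie y z) + lie y (lie z x) + lie z (lie x y) = 0
}.

#[short(type="lieAlgType")]
HB.structure Definition LieAlgebra (K : fieldType) :=
  {L of Vector K L & Vector_isLieAlgebra K L}.

Definition lie_isomorphic (K : fieldType) (L M : lieAlgType K) : Prop :=
  exists f : {linear L -> M},
    bijective f /\ forall x y : L, f (lie x y) = lie (f x) (f y).

Definition is_derivation (K : fieldType) (L : lieAlgType K) (f : 'End(L)) : Prop :=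
  forall x y : L, f (lie x y) = lie (f x) y + lie x (f y).

Definition diagonalizable_end (K : fieldType) (V : vectType K) (f : 'End(V)) : Prop :=
  exists b : seq V,
    basis_of fullv b /\ forall v : V, v \in b -> exists a : K, f v = a *: v.

(* The bracket of Der(L) is the commutator, so a subspace of Der(L) whose
   elements commute pairwise is automatically a subalgebra. *)
Definition is_torus (K : fieldType) (L : lieAlgType K)
    (T : {vspace 'End(L)}) : Prop :=
  [/\ forall f, f \in T -> is_derivation f,
      forall f, f \in T -> diagonalizable_end f
    & forall f g, f \in T -> g \in T -> (f \o g)%VF = (g \o f)%VF].

Definition is_maximal_torus (K : fieldType) (L : lieAlgType K)
    (T : {vspace 'End(L)}) : Prop :=
  is_torus T /\
  forall T' : {vspace 'End(L)}, is_torus T' -> (T <= T')%VS -> T' = T.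

(* The rank is the common dimension of the maximal tori: the second clause says
   that they all have dimension r, the first that there is one. *)
Definition has_rank (K : fieldType) (L : lieAlgType K) (r : nat) : Prop :=
  (exists T : {vspace 'End(L)}, is_maximal_torus T) /\
  forall T : {vspace 'End(L)}, is_maximal_torus T -> \dim T = r.

(* The i-th vector of the standard basis of K^n (0 if n <= i). *)
Definition bvec (K : fieldType) (n i : nat) : 'rV[K]_n := \row_j (j == i :> nat)%N%:R.

(* t i j is the listed value of the bracket of the i-th and j-th basis vectors,
   and 0 when this bracket is not listed.  The tables below list pairs with
   i < j only, so t i j - t j i is the extension by antisymmetry. *)
Definition table_bracket (K : fieldType) (n : nat) (t : nat -> nat -> 'rV[K]_n)
    (u v : 'rV[K]_n) : 'rV[K]_n :=
  \sum_(i < n) \sum_(j < n) (u 0 i * v 0 j) *: (t i j - t j i).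

Definition Q_table (K : fieldType) (m i j : nat) : 'rV[K]_(2 * m) :=
  let n := (2 * m)%N in let X := bvec K n in
    (if (i == 0)%N && (1 <= j <= n - 3)%N then X j.+1 else 0)
  + (if (1 <= i <= m - 1)%N && (j == n - i - 1)%N
     then (-1) ^+ (i - 1) *: X (n - 1)%N else 0).

(* The parameter alpha_k, 1 <= k <= m-2, is the value of alpha at the ordinal
   k-1. *)
Definition C_table (K : fieldType) (m : nat) (alpha : 'I_(m - 2) -> K)
    (i j : nat) : 'rV[K]_(2 * m) :=
  let n := (2 * m)%N in let Y := bvec K n in
    (if (i == 0)%N && (1 <= j <= n - 3)%N then Y j.+1 else 0)
  + (if (1 <= i <= m - 1)%N && (j == n - i - 1)%N
     then (-1) ^+ i *: Y (n - 1)%N else 0)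
  + \sum_(k0 < m - 2) (let k := k0.+1 in
      if (1 <= i <= m - k - 1)%N && (j == n - (2 * k + 1) - i)%N
      then ((-1) ^+ i.+1 * alpha k0) *: Y (n - 1)%N else 0).

Section TableBracket.
Variables (K : fieldType) (n : nat) (t : nat -> nat -> 'rV[K]_n).
Local Notation tb := (table_bracket t).

Lemma table_bracketDl (a : K) (x y z : 'rV[K]_n) :
  tb (a *: x + y) z = a *: tb x z + tb y z.
Proof.
rewrite /table_bracket scaler_sumr -big_split; apply: eq_bigr => i _ /=.
rewrite scaler_sumr -big_split; apply: eq_bigr => j _ /=.
by rewrite scalerA -scalerDl !mxE; congr (_ *: _); ring.
Qed.

Lemma table_bracketC (x y : 'rV[K]_n) : tb x y = - tb y x.
Proof.
rewrite /table_bracket exchange_big -sumrN; apply: eq_bigr => i _ /=.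
rewrite -sumrN; apply: eq_bigr => j _ /=.
by rewrite -scalerN opprB mulrC.
Qed.

Lemma table_bracketDr (a : K) (x y z : 'rV[K]_n) :
  tb z (a *: x + y) = a *: tb z x + tb z y.
Proof.
by rewrite table_bracketC table_bracketDl opprD -scalerN -!table_bracketC.
Qed.

Lemma table_bracketxx (x : 'rV[K]_n) : tb x x = 0.
Proof.
rewrite /table_bracket.
under eq_bigr => i _ do under eq_bigr => j _ do rewrite scalerBr.
under eq_bigr => i _ do rewrite sumrB.
rewrite sumrB [X in _ - X]exchange_big /= -sumrB big1 //= => i _.
rewrite -sumrB big1 //= => j _.
by rewrite (mulrC (x 0 j)) subrr.
Qed.

Lemma table_bracket_bvec (i j : nat) : (i < n)%N -> (j < n)%N ->
  tb (bvec K n i) (bvec K n j) = t i j - t j i.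
Proof.
move=> lin ljn; rewrite /table_bracket.
rewrite (bigD1 (Ordinal lin)) //= (bigD1 (Ordinal ljn)) //= !mxE !eqxx mulr1.
rewrite scale1r !big1 ?addr0 // => k /negbTE; rewrite -val_eqE /= => nk.
  by rewrite big1 // => l _; rewrite !mxE nk mul0r scale0r.
by rewrite !mxE nk mulr0 scale0r.
Qed.

(* Tables consisting of the shift X_j |-> X_{j+1}, 1 <= j <= n-3, by X_0 and of
   an alternating form s with values in the line of X_{n-1}. *)
Variable w : nat -> nat -> K.
Let s i j := w i j - w j i.
Hypothesis n1 : (n != 1)%N.
Hypothesis tE : forall i j, t i j =
  (if (i == 0)%N && (1 <= j <= n - 3)%N then bvec K n j.+1 else 0)
  + w i j *: bvec K n (n - 1).
Hypothesis s_last : forall j, s (n - 1)%N j = 0.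
Hypothesis s_shift : forall i j, (i < n)%N -> (j < n)%N ->
  (1 <= i <= n - 3)%N%:R * s i.+1 j + (1 <= j <= n - 3)%N%:R * s i j.+1 = 0.

Let e := bvec K n (n - 1).
Let hd (u : 'rV[K]_n) : K := \sum_(i < n | (i == 0 :> nat)%N) u 0 i.
Let D (u : 'rV[K]_n) : 'rV[K]_n :=
  \sum_(j < n) (u 0 j * (1 <= j <= n - 3)%N%:R) *: bvec K n j.+1.
Let B (u v : 'rV[K]_n) : K := \sum_(i < n) \sum_(j < n) u 0 i * v 0 j * s i j.

Let hdD (a : K) x y : hd (a *: x + y) = a * hd x + hd y.
Proof.
rewrite /hd mulr_sumr -big_split; apply: eq_bigr => i _; by rewrite !mxE.
Qed.

Let DD (a : K) x y : D (a *: x + y) = a *: D x + D y.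
Proof.
rewrite /D scaler_sumr -big_split; apply: eq_bigr => i _ /=.
by rewrite scalerA -scalerDl !mxE; congr (_ *: _); ring.
Qed.

Let BD (a : K) x y z : B (a *: x + y) z = a * B x z + B y z.
Proof.
rewrite /B mulr_sumr -big_split; apply: eq_bigr => i _ /=.
rewrite mulr_sumr -big_split; apply: eq_bigr => j _ /=.
by rewrite !mxE; ring.
Qed.

Let BC x y : B x y = - B y x.
Proof.
rewrite /B exchange_big -sumrN; apply: eq_bigr => i _ /=.
rewrite -sumrN; apply: eq_bigr => j _ /=.
by rewrite /s; ring.
Qed.

Let hd_bvec i : (0 < i)%N -> hd (bvec K n i) = 0.
Proof.
move=> i0; rewrite /hd big1 // => j /eqP j0; rewrite !mxE j0.
by case: i i0.
Qed.

Let hde : hd e = 0.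
Proof.
have [n0|/hd_bvec//] := posnP (n - 1).
by rewrite /hd big1 // => -[i li] _; exfalso; move: n1 => /eqP; lia.
Qed.

Let hdDv v : hd (D v) = 0.
Proof.
have hd0 : hd 0 = 0 by rewrite /hd big1 // => i _; rewrite mxE.
rewrite /D; elim/big_ind : _ => [//|x y hx hy|i _].
  by rewrite -[x]scale1r hdD hx hy mulr0 addr0.
by rewrite -[_ *: _]addr0 hdD hd0 hd_bvec // mulr0 addr0.
Qed.

Let De : D e = 0.
Proof.
rewrite /D big1 // => i _; rewrite mxE.
case: eqP => [->|_]; last by rewrite mul0r scale0r.
case: (boolP (_ <= _ <= _)%N) => [H|_]; last by rewrite mulr0 scale0r.
by exfalso; lia.
Qed.

Let B_bvec i v : (i < n)%N -> B (bvec K n i) v = \sum_(j < n) v 0 j * s i j.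
Proof.
move=> lin; rewrite /B (bigD1 (Ordinal lin)) //= [X in _ + X]big1 => [|k].
  by rewrite addr0; apply: eq_bigr => j _; rewrite !mxE eqxx mul1r.
rewrite -val_eqE /= => /negbTE nk; rewrite big1 // => j _.
by rewrite !mxE nk !mul0r.
Qed.

Let Be v : B e v = 0.
Proof.
have [n0|n0] := posnP n.
  by rewrite /B big1 // => -[i li]; exfalso; move: li; rewrite n0.
by rewrite B_bvec ?subn1 ?prednK // big1 // => j _; rewrite -subn1 s_last mulr0.
Qed.

Let BDl u v : B (D u) v =
  \sum_(i < n) \sum_(j < n) u 0 i * v 0 j * ((1 <= i <= n - 3)%N%:R * s i.+1 j).
Proof.
have B0 : B 0 v = 0.
  by rewrite /B big1 // => i _; rewrite big1 // => j _; rewrite mxE !mul0r.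
rewrite /D; elim/big_rec2 : _ => [//|i x y _ <-].
rewrite BD; congr (_ + _).
case: (boolP (_ <= _ <= _)%N) => [H|_]; last first.
  by rewrite mulr0 mul0r big1 // => j _; rewrite mul0r mulr0.
rewrite B_bvec; last by lia.
by rewrite mulr_sumr; apply: eq_bigr => j _ /=; ring.
Qed.

Let Bshift u v : B (D u) v + B u (D v) = 0.
Proof.
rewrite (BC u) !BDl [X in _ - X]exchange_big /= -sumrB big1 // => i _.
rewrite -sumrB big1 // => j _.
have := s_shift (ltn_ord i) (ltn_ord j).
set a := _%:R * _; set b := _%:R * s i _ => ab.
have -> : (1 <= j <= n - 3)%N%:R * s j.+1 i = - b by rewrite /b /s; ring.
by rewrite -[RHS](mulr0 (u 0 i * v 0 j)) -ab; ring.
Qed.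

Let tbE u v : tb u v = hd u *: D v - hd v *: D u + B u v *: e.
Proof.
have E (x y : 'rV[K]_n) : \sum_(i < n) \sum_(j < n) (x 0 i * y 0 j) *:
    (if (i == 0 :> nat)%N && (1 <= j <= n - 3)%N then bvec K n j.+1 else 0)
    = hd x *: D y.
  rewrite /hd [X in _ = X *: _]big_mkcond scaler_suml; apply: eq_bigr => i _.
  rewrite /D scaler_sumr; apply: eq_bigr => j _.
  case: eqP => [_|_] /=; last by rewrite scale0r scaler0.
  by case: ifP => _; rewrite ?scaler0 ?mulr0 ?mulr1 ?scale0r ?scaler0 ?scalerA.
rewrite -!E [X in _ - X]exchange_big /= -sumrB /B scaler_suml -big_split.
apply: eq_bigr => i _ /=; rewrite -sumrB scaler_suml -big_split.
apply: eq_bigr => j _ /=; rewrite !tE /s -!/e.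
by rewrite opprD addrACA -scalerBl scalerDr scalerBr scalerA [v 0 j * u 0 i]mulrC.
Qed.

Lemma table_bracketJ (x y z : 'rV[K]_n) :
  tb x (tb y z) + tb y (tb z x) + tb z (tb x y) = 0.
Proof.
have hd0 : hd 0 = 0 by rewrite /hd big1 // => i _; rewrite mxE.
have hdb u v : hd (tb u v) = 0.
  rewrite tbE -addrA -scaleNr !hdD -[B u v *: e]addr0 hdD !hdDv hde hd0.
  by rewrite !mulr0 !addr0.
have D0 : D 0 = 0 by rewrite /D big1 // => i _; rewrite mxE mul0r scale0r.
have Db u v : D (tb u v) = hd u *: D (D v) - hd v *: D (D u).
  by rewrite tbE -addrA -scaleNr !DD -[B u v *: e]addr0 DD De D0 scaler0 !addr0 scaleNr.
have B0 v : B 0 v = 0.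
  by rewrite /B big1 // => i _; rewrite big1 // => j _; rewrite mxE !mul0r.
have Bb x' u v : B x' (tb u v) = - (hd u * B (D v) x' - hd v * B (D u) x').
  rewrite BC tbE -addrA -scaleNr !BD -[B u v *: e]addr0 BD Be B0.
  by rewrite mulr0 !addr0 mulNr.
have Bs u v : B (D u) v = B (D v) u.
  by apply: subr0_eq; rewrite [B (D v) u]BC opprK Bshift.
have tt u a b : tb u (tb a b) = hd u *: (hd a *: D (D b) - hd b *: D (D a))
   - (hd a * B (D b) u - hd b * B (D a) u) *: e.
  by rewrite [LHS]tbE hdb Db scale0r subr0 Bb scaleNr.
rewrite !tt (Bs z y) (Bs z x) (Bs y x).
apply/rowP => k; rewrite !mxE.
by ring.
Qed.
End TableBracket.

(* The antidiagonal form with w(i, j) = (-1)^i c for i + j = 2m - (2k+1). *)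
Definition antidiag (K : fieldType) (m k : nat) (c : K) (i j : nat) : K :=
  if (1 <= i <= m - k - 1)%N && (j == 2 * m - (2 * k + 1) - i)%N
  then (-1) ^+ i * c else 0.

Lemma antidiagB (K : fieldType) (m k : nat) (c : K) (i j : nat) :
  antidiag m k c i j - antidiag m k c j i =
  if [&& (1 <= i)%N, (1 <= j)%N & (i + j + 2 * k + 1 == 2 * m)%N]
  then (-1) ^+ i * c else 0.
Proof.
rewrite /antidiag; case: ifP => H1; case: ifP => H2; case: ifP => H3;
  rewrite ?subr0 ?sub0r ?oppr0 //; try by exfalso; lia.
rewrite -mulNr -(signr_odd _ i) -(signr_odd _ j).
have -> : odd i = ~~ odd j by lia.
by case: (odd j); rewrite /= ?expr0 ?expr1 ?opprK.
Qed.

Lemma antidiag_last (K : fieldType) (m k : nat) (c : K) (j : nat) :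
  antidiag m k c (2 * m - 1) j - antidiag m k c j (2 * m - 1) = 0.
Proof. by rewrite antidiagB; case: ifP => // H; exfalso; lia. Qed.

Lemma antidiag_shift (K : fieldType) (m k : nat) (c : K) (i j : nat) :
  (1 <= i <= 2 * m - 3)%N%:R * (antidiag m k c i.+1 j - antidiag m k c j i.+1)
  + (1 <= j <= 2 * m - 3)%N%:R * (antidiag m k c i j.+1 - antidiag m k c j.+1 i)
  = 0.
Proof.
rewrite !antidiagB; case: ifP => H1; case: ifP => H2; rewrite ?mulr0 ?addr0 ?add0r //.
- have -> : (1 <= i <= 2 * m - 3)%N by lia.
  have -> : (1 <= j <= 2 * m - 3)%N by lia.
  by rewrite !mul1r exprS; ring.
- have -> : (1 <= i <= 2 * m - 3)%N = false by lia.
  by rewrite mul0r.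
- have -> : (1 <= j <= 2 * m - 3)%N = false by lia.
  by rewrite mul0r.
Qed.

Lemma Q_tableJ (K : fieldType) (m : nat) (x y z : 'rV[K]_(2 * m)) :
  let b := table_bracket (@Q_table K m) in
  b x (b y z) + b y (b z x) + b z (b x y) = 0.
Proof.
apply: (@table_bracketJ K (2 * m) (@Q_table K m) (antidiag m 0 (-1))).
- by lia.
- move=> i j; rewrite /Q_table /antidiag; congr (_ + _).
  rewrite !subn0 muln0 add0n subnAC.
  case: ifP => [H|_]; last by rewrite scale0r.
  by congr (_ *: _); case: i H => // i _; rewrite subSS subn0 exprS; ring.
- by move=> j; exact: antidiag_last.
- by move=> i j _ _; exact: antidiag_shift.
Qed.

Lemma C_tableJ (K : fieldType) (m : nat) (alpha : 'I_(m - 2) -> K)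
    (x y z : 'rV[K]_(2 * m)) :
  let b := table_bracket (C_table alpha) in
  b x (b y z) + b y (b z x) + b z (b x y) = 0.
Proof.
pose w i j := antidiag m 0 (1 : K) i j
              + \sum_(k < m - 2) antidiag m k.+1 (- alpha k) i j.
have wB i j : w i j - w j i = (antidiag m 0 1 i j - antidiag m 0 1 j i)
   + \sum_(k < m - 2) (antidiag m k.+1 (- alpha k) i j
                       - antidiag m k.+1 (- alpha k) j i).
  by rewrite /w opprD addrACA sumrB.
apply: (@table_bracketJ K (2 * m) (C_table alpha) w).
- by lia.
- move=> i j; rewrite /C_table /w -addrA scalerDl; congr (_ + (_ + _)).
    rewrite /antidiag !subn0 muln0 add0n subnAC mulr1.
    by case: ifP => [H|_]; rewrite ?scale0r.
  rewrite scaler_suml; apply: eq_bigr => k _ /=; rewrite /antidiag.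
  case: ifP => [H|_]; last by rewrite scale0r.
  by congr (_ *: _); rewrite exprS; ring.
- move=> j; rewrite wB antidiag_last big1 ?addr0 // => k _.
  exact: antidiag_last.
- move=> i j _ _; rewrite !wB [X in X + _]mulrDr [X in _ + X]mulrDr addrACA antidiag_shift add0r.
  rewrite !mulr_sumr -big_split big1 // => k _ /=.
  exact: antidiag_shift.
Qed.

Definition Q_alg (K : fieldType) (m : nat) : Type := 'rV[K]_(2 * m).

HB.instance Definition _ (K : fieldType) (m : nat) := Vector.on (@Q_alg K m).
HB.instance Definition _ (K : fieldType) (m : nat) :=
  Vector_isLieAlgebra.Build K (@Q_alg K m)
    (@table_bracketDl K (2 * m) (@Q_table K m))
    (@table_bracketDr K (2 * m) (@Q_table K m))
    (@table_bracketxx K (2 * m) (@Q_table K m))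
    (@Q_tableJ K m).

(* The carrier does not depend on alpha, which only selects the bracket. *)
Definition C_alg (K : fieldType) (m : nat) (alpha : 'I_(m - 2) -> K) : Type :=
  'rV[K]_(2 * m).

HB.instance Definition _ (K : fieldType) (m : nat) (alpha : 'I_(m - 2) -> K) :=
  Vector.on (C_alg alpha).
HB.instance Definition _ (K : fieldType) (m : nat) (alpha : 'I_(m - 2) -> K) :=
  Vector_isLieAlgebra.Build K (C_alg alpha)
    (@table_bracketDl K (2 * m) (C_table alpha))
    (@table_bracketDr K (2 * m) (C_table alpha))
    (@table_bracketxx K (2 * m) (C_table alpha))
    (@C_tableJ K m alpha).

(* Main.v *)
(* Let V be the span of u_i = Y_{i+1}, 0 <= i < N = n - 2; it is cyclic under
   A = ad Y_0, and the bracket induces on it an alternating form for which A is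
   skew.  Such a form is B(A^i u_0, A^j u_0) = (-1)^i g(i + j) with g supported on
   odd numbers.  Replacing u_0 by p(A^2) u_0 multiplies the generating polynomial of
   g by p^2, so p can be chosen to leave only the value at N - 1, and this is Q_n.

   For the rank, let T be a torus.  The ideal spanned by V and Y_{n-1}, the
   centralizer of the last two basis vectors and the derived algebra are stable
   under derivations, hence T has common eigenvectors y_0, y_1 that generate the
   algebra and define a basis of the same kind.  If its form g is not concentrated
   at N - 1, then comparing the weights of Y_{n-1} shows that T kills y_0, so the
   change of y_1 above preserves weight vectors.  In both cases T lies in the
   two-dimensional torus of derivations diagonal in a basis of Q_n type. *)

Require Import Defs.
From HB Require Import structures.
From mathcomp Require Import all_boot all_order all_algebra.
From mathcomp Require Import zify ring.
From mathcomp Require Import reals complex.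

Set Implicit Arguments.
Unset Strict Implicit.
Unset Printing Implicit Defensive.

Import GRing.Theory.
Local Open Scope ring_scope.

(** * Common eigenvectors of commuting diagonalizable endomorphisms *)

Section LinearAlgebra.
Variable K : fieldType.
Implicit Types V W : vectType K.

Lemma span_ind V (P : V -> Prop) (X : seq V) :
    P 0 -> (forall a v w, P v -> P w -> P (a *: v + w)) ->
    (forall v, v \in X -> P v) ->
  forall v, v \in <<X>>%VS -> P v.
Proof.
move=> P0 PD PX v /(@coord_span _ _ _ (in_tuple X)) ->.
elim/big_rec: _ => // i w _ Pw; apply: PD => //.
by apply: PX; rewrite mem_nth //= ltn_ord.
Qed.

Lemma basis_ind V (P : V -> Prop) (X : seq V) :
    basis_of fullv X -> P 0 ->
    (forall a v w, P v -> P w -> P (a *: v + w)) ->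
    (forall v, v \in X -> P v) ->
  forall v, P v.
Proof.
move=> bX P0 PD PX v; apply: (span_ind P0 PD PX).
by rewrite (span_basis bX) memvf.
Qed.

Lemma basis_extend V W (X : seq V) (Y : seq W) :
    basis_of fullv X ->
  exists f : 'Hom(V, W), forall i, (i < size X)%N -> f X`_i = Y`_i.
Proof.
move=> bX; pose T := in_tuple X.
pose h (v : V) : W := \sum_(j < size X) coord T j v *: Y`_j.
have hlin : linear h.
  move=> a v w; rewrite /h scaler_sumr -big_split; apply: eq_bigr => j _ /=.
  by rewrite linearP scalerDl scalerA.
pose hL := GRing.isLinear.Build K V W *:%R h hlin.
pose hl : {linear V -> W} := HB.pack h hL.
exists (linfun hl) => i iX; rewrite lfunE /= /h.
rewrite (bigD1 (Ordinal iX)) //= (coord_free (Ordinal iX)) ?(basis_free bX) //.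
rewrite eqxx scale1r big1 ?addr0 // => j nj.
rewrite (coord_free (Ordinal iX)) ?(basis_free bX) //.
by rewrite eq_sym (negbTE nj) scale0r.
Qed.

(* By induction on [s]: either the product of the other factors maps [v] to an
   eigenvector outside [U], or the factor [f - a] can be dropped after
   subtracting an element of [U] from [v]. *)
Lemma eigenvector_outside V (f : 'End(V)) (U : {vspace V}) (s : seq K) (v : V) :
    uniq s -> v \notin U ->
    foldr (fun a w => f w - a *: w) v s = 0 ->
  exists w, [/\ w \notin U, exists a, f w = a *: w
    & forall W : {vspace V}, (forall y, y \in W -> f y \in W) ->
        v \in W -> w \in W].
Proof.
pose q r y : V := foldr (fun a w => f w - a *: w) y r.
have qB r y y' c : q r (y - c *: y') = q r y - c *: q r y'.
  elim: r => //= a r ->; rewrite linearB linearZ /=.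
  by rewrite !scalerBr !scalerA (mulrC a) !opprD !opprK addrACA.
have qW r y (W : {vspace V}) : (forall y, y \in W -> f y \in W) ->
    y \in W -> q r y \in W.
  by move=> Wf Wy; elim: r => //= a r IH; rewrite rpredB ?Wf ?rpredZ.
have q_eig r y a : f y = a *: y -> q r y = \prod_(b <- r) (a - b) *: y.
  move=> fy; elim: r => [|b r IH] /=; first by rewrite big_nil scale1r.
  by rewrite IH linearZ /= fy big_cons !scalerA -scalerBl; congr (_ *: _); ring.
elim: s v => [|a s IH] v /=.
  by move=> _ vU v0; move: vU; rewrite v0 mem0v.
case/andP=> as_ us vU; rewrite -/(q s v) => /subr0_eq fq.
have [qU|qU] := boolP (q s v \in U); last first.
  exists (q s v); split=> //; first by exists a.
  by move=> W fW vW; apply: qW.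
(* The factors left act on the eigenvector [w] by the product of the [a - b], nonzero because [a] is
   not in [s]. Hence they kill [v - c *: w], which stays outside [U] since [w] is in [U]. *)
set w := q s v in fq qU; pose c := (\prod_(b <- s) (a - b))^-1.
have c0 : \prod_(b <- s) (a - b) != 0.
  rewrite prodf_seq_neq0; apply/allP => b bs /=; rewrite subr_eq0.
  by apply: contraNneq as_ => ->.
have [||y [yU ey yW]] := IH (v - c *: w) us.
- by apply: contra vU => vcU; rewrite -(subrK (c *: w) v) rpredD ?rpredZ.
- by rewrite -/(q s _) qB (q_eig _ _ _ fq) scalerA mulVf // scale1r subrr.
exists y; split=> // W fW vW; apply: yW => //.
by rewrite rpredB ?rpredZ // qW.
Qed.

(** The list [s] collects the eigenvalues on an eigenbasis, without repetition. The factors commute,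
    so each basis vector is killed by the one that carries its own eigenvalue. *)
Lemma diagonalizable_annihilator V (f : 'End(V)) :
    diagonalizable_end f ->
  exists2 s : seq K, uniq s &
    forall v, foldr (fun a w => f w - a *: w) v s = 0.
Proof.
case=> b [bb eb].
have [s sP] : exists s : seq K, forall v, v \in b ->
    exists2 a, a \in s & f v = a *: v.
  elim: b eb {bb} => [|v b IH] eb; first by exists [::].
  have [s sP] := IH (fun w wb => eb w (@mem_behead _ (v :: b) w wb)).
  have [a fa] := eb v (mem_head _ _).
  exists (a :: s) => w; rewrite inE => /predU1P[->|/sP[c cs fw]].
    by exists a; rewrite ?mem_head.
  by exists c; rewrite // inE cs orbT.
exists (undup s); first exact: undup_uniq.
set q := foldr _ ; move: (undup s) (fun a => mem_undup s a) => t st.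
apply: (basis_ind bb).
- by elim: t {st} => //= a t ->; rewrite linear0 scaler0 subr0.
- move=> c v w; suff -> : q (c *: v + w) t = c *: q v t + q w t.
    by move=> -> ->; rewrite scaler0 addr0.
  elim: t {st} => //= a t ->; rewrite linearP /= scalerDr scalerBr !scalerA.
  by rewrite opprD addrACA (mulrC a).
move=> v /sP[a]; rewrite -st => {st} at_ fv.
have qe r : q v r = \prod_(b <- r) (a - b) *: v.
  elim: r => [|e r IH] /=; first by rewrite big_nil scale1r.
  by rewrite IH linearZ /= fv big_cons !scalerA -scalerBl; congr (_ *: _); ring.
rewrite qe; suff /eqP -> : \prod_(b <- t) (a - b) == 0 by rewrite scale0r.
by rewrite prodf_seq_eq0; apply/hasP; exists a; rewrite //= subrr.
Qed.

(** Induction over a basis of [T]: a vector that is already an eigenvector for the earlier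
    endomorphisms is refined to one for the next, without leaving [W] or entering [U]. *)
Lemma common_eigenvector V (T U W : {vspace _}) :
    (forall f : 'End(V), f \in T -> diagonalizable_end f) ->
    (forall f g : 'End(V), f \in T -> g \in T -> (f \o g)%VF = (g \o f)%VF) ->
    (forall (f : 'End(V)) y, f \in T -> y \in W -> f y \in W) ->
    ~~ (W <= U)%VS ->
  exists w, [/\ w \in W, w \notin U
    & forall f : 'End(V), f \in T -> exists a, f w = a *: w].
Proof.
move=> dT cT sT /subvPn[v0 v0W v0U].
suff [w [wW wU ew]] : exists w, [/\ w \in W, w \notin U
    & forall f : 'End(V), f \in (vbasis T : seq _) -> exists a, f w = a *: w].
  exists w; split=> // f; rewrite -(span_basis (vbasisP T)).
  apply: (span_ind (P := fun f : 'End(V) => exists a, f w = a *: w)) => //.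
    by exists 0; rewrite lfunE /= scale0r.
  move=> c g h [a ga] [b hb]; exists (c * a + b).
  by rewrite add_lfunE scale_lfunE ga hb scalerA scalerDl.
have: {subset (vbasis T : seq _) <= T} by move=> f; apply: vbasis_mem.
elim: (vbasis T : seq _) => [|f r IH] rT; first by exists v0; split.
have [|w [wW wU ew]] := IH; first by move=> g gr; apply: rT; rewrite inE gr orbT.
have fT : f \in T by apply: rT; rewrite mem_head.
have [s us sP] := diagonalizable_annihilator (dT f fT).
have [y [yU ey yW]] := eigenvector_outside us wU (sP w).
exists y; split=> //; first by apply: yW => // x xW; apply: sT.
move=> g; rewrite inE => /predU1P[->//|gr].
have [a ga] := ew g gr; exists a; apply/eqP; rewrite -subr_eq0.
have gE x : (x \in lker (g - a *: \1%VF)) = (g x - a *: x == 0).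
  by rewrite memv_ker add_lfunE opp_lfunE scale_lfunE id_lfunE.
(* The eigenspace of [g] is stable under [f] because the two commute, so the refined vector [y]
   remains in it. *)
rewrite -gE; apply: yW; last by rewrite gE ga subrr.
have gT : g \in T by apply: rT; rewrite inE gr orbT.
move=> x; rewrite !gE => /eqP/subr0_eq gx.
by rewrite -comp_lfunE (cT g f) // comp_lfunE gx linearZ subrr.
Qed.

End LinearAlgebra.

(** * Frames and their characteristic flag *)

Section LieBilinear.
Variables (K : fieldType) (L : lieAlgType K).

HB.instance Definition _ (x : L) :=
  GRing.isLinear.Build K L L *:%R (lie x) (fun a y z => lieDr a y z x).

Lemma lie_antisym (x y : L) : lie x y = - lie y x.
Proof.
apply/eqP; rewrite -addr_eq0; apply/eqP.
have := liexx (x + y); have := lieDl 1 x y (x + y).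
by rewrite !scale1r => ->; rewrite !linearD /= !liexx addr0 add0r.
Qed.

Lemma lie0l (y : L) : lie 0 y = 0.
Proof. by rewrite lie_antisym linear0 oppr0. Qed.

Lemma lie0r (y : L) : lie y 0 = 0.
Proof. exact: linear0. Qed.

Lemma lie_addl (x y z : L) : lie (x + y) z = lie x z + lie y z.
Proof. by rewrite -[x]scale1r lieDl !scale1r. Qed.

Lemma lie_addr (x y z : L) : lie z (x + y) = lie z x + lie z y.
Proof. exact: linearD. Qed.

Lemma lie_scalel a (x z : L) : lie (a *: x) z = a *: lie x z.
Proof. by rewrite -[a *: x]addr0 lieDl lie0l addr0. Qed.

Lemma lie_scaler a (x z : L) : lie z (a *: x) = a *: lie z x.
Proof. exact: linearZ. Qed.

Lemma lie_suml (I : Type) (r : seq I) (E : I -> L) (y : L) :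
  lie (\sum_(k <- r) E k) y = \sum_(k <- r) lie (E k) y.
Proof. exact: (big_morph (fun w => lie w y) (fun v w => lie_addl v w y) (lie0l y)). Qed.

Lemma lie_sumr (I : Type) (r : seq I) (E : I -> L) (y : L) :
  lie y (\sum_(k <- r) E k) = \sum_(k <- r) lie y (E k).
Proof. exact: linear_sum. Qed.

Lemma lie_leibniz (x y z : L) :
  lie x (lie y z) = lie (lie x y) z + lie y (lie x z).
Proof.
apply/eqP; rewrite -subr_eq0 opprD addrA.
rewrite [lie (lie x y) z]lie_antisym [lie x z]lie_antisym [lie y (- _)]linearN !opprK.
by rewrite addrAC lieJ.
Qed.

End LieBilinear.

Section Frame.
Variables (K : fieldType) (L : lieAlgType K) (N : nat).

(* In the notation of the paper, N = n - 2, x = Y_0, u i = Y_{i+1} and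
   z = Y_{n-1}; C_n has g (N - 1) = -1 and g (N - 1 - 2 k) = alpha_k. *)
Record frame (x z : L) (u : nat -> L) (g : nat -> K) : Prop := Frame {
  frame_basis : basis_of fullv (x :: rcons (mkseq u N) z);
  frame_xu : forall i, lie x (u i) = u i.+1;
  frame_nil : forall i, (N <= i)%N -> u i = 0;
  frame_xz : lie x z = 0;
  frame_uz : forall i, lie (u i) z = 0;
  frame_uu : forall i j, lie (u i) (u j) = ((-1) ^+ i * g (i + j)%N) *: z;
  frame_nondeg : g N.-1 != 0
}.

Definition flag (z : L) (u : nat -> L) (i : nat) : {vspace L} :=
  <<drop i (rcons (mkseq u N) z)>>%VS.

(** * Linear algebra of the flag *)

Section Flag.
Variables (x z : L) (u : nat -> L).
Local Notation F := (flag z u).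

Lemma flag_last : F N = <[z]>%VS.
Proof. by rewrite /flag -cats1 drop_cat size_mkseq ltnn subnn drop0 span_seq1. Qed.

Lemma flag_rec i : (i < N)%N -> F i = (<[u i]> + F i.+1)%VS.
Proof.
move=> iN; rewrite /flag (drop_nth 0) ?size_rcons ?size_mkseq 1?ltnW // span_cons.
by rewrite nth_rcons size_mkseq iN nth_mkseq.
Qed.

Lemma flag_le i j : (i <= j)%N -> (F j <= F i)%VS.
Proof.
move=> ij; apply: sub_span => v; rewrite -(subnK ij) -drop_drop.
exact: mem_drop.
Qed.

Lemma flag_memP i v : (i < N)%N -> v \in F i ->
  exists a, exists2 r, r \in F i.+1 & v = a *: u i + r.
Proof.
move=> iN; rewrite flag_rec // => /memv_addP[_ /vlineP[a ->]] [r rF ->].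
by exists a, r.
Qed.

Lemma flag_ind i (P : L -> Prop) :
    P 0 -> (forall a v w, P v -> P w -> P (a *: v + w)) ->
    (forall j, (i <= j < N)%N -> P (u j)) -> P z ->
  forall v, v \in F i -> P v.
Proof.
move=> P0 PD Pu Pz; apply: span_ind => // v /(nthP 0)[k].
rewrite size_drop size_rcons size_mkseq => ki <-.
rewrite nth_drop nth_rcons size_mkseq; case: ltnP => [kN|kN].
  by rewrite nth_mkseq //; apply: Pu; lia.
by have -> : (i + k == N)%N by lia.
Qed.

Hypothesis b : basis_of fullv (x :: rcons (mkseq u N) z).

Lemma flag_full v : exists a, exists2 r, r \in F 0 & v = a *: x + r.
Proof.
have := memvf v; rewrite -(span_basis b) span_cons.
move=> /memv_addP[_ /vlineP[a ->]] [r rF ->]; exists a, r => //.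
by rewrite /flag drop0.
Qed.

Lemma flag_free i : (i < N)%N -> u i \notin F i.+1.
Proof.
move=> iN; move: (basis_free b); rewrite free_cons => /andP[_].
rewrite -(cat_take_drop i (rcons _ _)) => /catr_free.
rewrite (drop_nth 0) ?size_rcons ?size_mkseq 1?ltnW // free_cons => /andP[].
by rewrite nth_rcons size_mkseq iN nth_mkseq.
Qed.

Lemma flag_x : x \notin F 0.
Proof.
by move: (basis_free b); rewrite free_cons /flag drop0 => /andP[].
Qed.

Lemma basis_z_neq0 : z != 0.
Proof.
apply: contraTneq (basis_free b) => ->.
by rewrite free_cons -cats1 cat_free seq1_free eqxx !andbF.
Qed.

Lemma basis_x_neq0 : x != 0.
Proof. by apply: contraNneq flag_x => ->; rewrite mem0v. Qed.

Lemma basis_u_neq0 i : (i < N)%N -> u i != 0.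
Proof. by move=> /flag_free; apply: contraNneq => ->; rewrite mem0v. Qed.

(** The number of vectors is right, so spanning suffices. Descending through the flag, each [u i] is
    recovered from [u' i] and later vectors because [c i] is invertible. *)
Lemma triangular_basis x' (u' : nat -> L) a (c : nat -> K) v (r : nat -> L) :
    a != 0 -> v \in F 0 -> x' = a *: x + v ->
    (forall i, (i < N)%N -> [/\ c i != 0, r i \in F i.+1 & u' i = c i *: u i + r i]) ->
  basis_of fullv (x' :: rcons (mkseq u' N) z).
Proof.
move=> a0 vF x'E u'E; rewrite basisEdim; apply/andP; split; last first.
  by rewrite -(span_basis b) (eqP (basis_free b)) /= !size_rcons !size_mkseq.
have FF' i : (i <= N)%N -> (F i <= flag z u' i)%VS.
  move=> /subKn <-; elim: (N - i)%N => [|k IH].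
    by rewrite subn0 /flag -!cats1 !drop_cat !size_mkseq ltnn.
  (* For [N <= k] both truncated differences are 0 and nothing changes. *)
  have [kN|Nk] := ltnP k N; last first.
    by move: IH; have -> : (N - k = N - k.+1)%N by lia.
  have iN : (N - k.+1 < N)%N by lia.
  have [c0 rF uE] := u'E _ iN.
  have ik : (N - k.+1).+1 = (N - k)%N by lia.
  rewrite flag_rec // [flag z u' _](_ : _ = (<[u' (N - k.+1)%N]> + flag z u' (N - k.+1).+1)%VS); last first.
    rewrite {1}/flag (drop_nth 0) ?size_rcons ?size_mkseq 1?ltnW // span_cons.
    by rewrite nth_rcons size_mkseq iN nth_mkseq.
  rewrite ik; rewrite ik in rF; move: uE rF c0.
  move: (c _) (u' _) (u _) (r _) => c0 u1 u0 r0 uE rF cn.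
  rewrite subv_add (subv_trans IH (addvSr _ _)) andbT -memvE.
  rewrite -[u0]scale1r -(mulVf cn) -scalerA rpredZ //.
  have -> : c0 *: u0 = u1 - r0 by rewrite uE addrK.
  rewrite rpredB //; first exact: subvP (addvSl _ _) _ (memv_line _).
  by apply: (subvP (addvSr _ _)); apply: (subvP IH).
rewrite -(span_basis b) !span_cons.
have /subvP FF0 : (<<rcons (mkseq u N) z>> <= <<rcons (mkseq u' N) z>>)%VS.
  by have := FF' 0 isT; rewrite /flag !drop0.
rewrite subv_add; apply/andP; split; last first.
  by apply: subv_trans (addvSr _ _); apply/subvP.
rewrite -memvE -[x]scale1r -(mulVf a0) -scalerA rpredZ //.
have -> : a *: x = x' - v by rewrite x'E addrK.
rewrite rpredB //; first exact: subvP (addvSl _ _) _ (memv_line _).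
by apply: (subvP (addvSr _ _)); apply: FF0; move: vF; rewrite /flag drop0.
Qed.

End Flag.

(** * Brackets, derivations and changes of generators in a frame *)

Section FrameTheory.
Variables (x z : L) (u : nat -> L) (g : nat -> K).
Hypothesis fr : frame x z u g.
Hypothesis N4 : (3 < N)%N.
Local Notation F := (flag z u).
Let b := frame_basis fr.

Lemma frame_z_neq0 : z != 0. Proof. exact: basis_z_neq0 b. Qed.

Lemma frame_g0 s : (N <= s)%N -> g s = 0.
Proof.
move=> Ns; have := frame_uu fr 0 s; rewrite (frame_nil fr Ns) linear0 mul1r.
by move=> /esym/eqP; rewrite scaler_eq0 (negbTE frame_z_neq0) orbF => /eqP.
Qed.

Lemma lie_x_top : lie x (u N.-1) = 0.
Proof. by rewrite (frame_xu fr) (frame_nil fr) //; lia. Qed.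

(** For even [s], antisymmetry of the bracket of [u 0] and [u s] reads [g s = - g s]. Combined with
    [frame_nondeg], this makes [N.-1] odd. *)
Lemma frame_g_even s : (2%:R : K) != 0 -> ~~ odd s -> g s = 0.
Proof.
move=> c2 es; have := lie_antisym (u 0) (u s); rewrite !(frame_uu fr) addn0 add0n.
rewrite -[(-1) ^+ s]signr_odd (negbTE es) !mul1r => /eqP.
rewrite -addr_eq0 -scalerDl scaler_eq0 (negbTE frame_z_neq0) orbF -mulr2n.
by rewrite -mulr_natl mulf_eq0 (negbTE c2) => /eqP.
Qed.

Lemma frame_ind (P : L -> Prop) :
    P 0 -> (forall a v w, P v -> P w -> P (a *: v + w)) ->
    P x -> (forall j, (j < N)%N -> P (u j)) -> P z -> forall v, P v.
Proof.
move=> P0 PD Px Pu Pz v; have [a [r rF ->]] := flag_full b v.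
by apply: (PD) => //; move: r rF; apply: flag_ind.
Qed.

Lemma lie_frame_z v : lie v z = 0.
Proof.
move: v; apply: frame_ind => [|a v w|||].
- exact: lie0l.
- by rewrite lieDl => -> ->; rewrite scaler0 addr0.
- exact: frame_xz fr.
- by move=> j _; exact: frame_uz fr j.
- exact: liexx.
Qed.

Lemma lie_flag0 v w : v \in F 0 -> w \in F 0 -> lie v w \in <[z]>%VS.
Proof.
move: v; apply: (flag_ind (P := fun v => w \in F 0 -> lie v w \in <[z]>%VS)) => [|a v v' IH IH' wF|j _|_].
- by rewrite lie0l mem0v.
- by rewrite lieDl rpredD ?rpredZ ?IH ?IH'.
- move: w; apply: (flag_ind (P := fun w => lie (u j) w \in <[z]>%VS)) => [|a v v' IH IH'|k _|].
  + by rewrite linear0 mem0v.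
  + by rewrite lieDr rpredD ?rpredZ ?IH ?IH'.
  + by rewrite (frame_uu fr) rpredZ ?memv_line.
  + by rewrite lie_frame_z mem0v.
- by rewrite lie_antisym lie_frame_z oppr0 mem0v.
Qed.

Lemma lie_flag y v i : (i < N)%N -> v \in F i -> lie y v \in F i.+1.
Proof.
move=> iN vF; have [a [w wF ->]] := flag_full b y; rewrite lieDl rpredD //.
  apply: rpredZ; move: v vF; apply: flag_ind => [|c v v' IH IH'|j jN|].
  - by rewrite linear0 mem0v.
  - by rewrite lieDr rpredD ?rpredZ ?IH ?IH'.
  - rewrite (frame_xu fr).
    have [jN'|Nj] := ltnP j.+1 N; last by rewrite (frame_nil fr) ?mem0v.
    apply: (subvP (flag_le z u (_ : i.+1 <= j.+1)%N)); first by lia.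
    by rewrite (flag_rec z u jN') (subvP (addvSl _ _)) ?memv_line.
  - by rewrite lie_frame_z mem0v.
have : lie w v \in <[z]>%VS by rewrite lie_flag0 // (subvP (flag_le z u (leq0n i))).
by rewrite -(flag_last z u); apply: subvP; apply: flag_le.
Qed.

Lemma lie_flag1_top v : v \in F 1 -> lie v (u N.-1) = 0.
Proof.
move: v; apply: flag_ind => [|c v v' IH IH'|j jN|].
- by rewrite lie0l.
- by rewrite lieDl IH IH' scaler0 addr0.
- by rewrite (frame_uu fr) frame_g0 ?mulr0 ?scale0r //; lia.
- by rewrite lie_antisym lie_frame_z oppr0.
Qed.

Lemma mem_flag i : (i <= N)%N -> u i \in F i.
Proof.
rewrite leq_eqVlt => /predU1P[->|iN]; first by rewrite (frame_nil fr) ?mem0v.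
by rewrite (flag_rec z u iN) (subvP (addvSl _ _)) ?memv_line.
Qed.

Lemma lie_in_flag1 v w : lie v w \in F 1.
Proof.
have [c [w' wF ->]] := flag_full b w; rewrite lieDr rpredD //; last first.
  by apply: lie_flag => //; lia.
apply: rpredZ; rewrite lie_antisym rpredN.
have [d [v' vF ->]] := flag_full b v.
by rewrite linearD linearZ /= liexx scaler0 add0r lie_flag //; lia.
Qed.

(** Induction along [u i.+1 = lie x (u i)]. It can start at [u 1] with no knowledge of [f (u 0)],
    because every bracket lies in [F 1]. *)
Lemma derivation_u (f : 'End(L)) i : is_derivation f ->
  (0 < i < N)%N -> f (u i) \in F i.
Proof.
move=> df; elim: i => [//|i IH] iN.
rewrite -(frame_xu fr) df rpredD //.
  case: i IH iN => [|i] IH iN; first exact: lie_in_flag1.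
  by apply: lie_flag; [lia | apply: mem_flag; lia].
case: i IH iN => [|i] IH iN; first exact: lie_in_flag1.
by apply: lie_flag; [lia | apply: IH; lia].
Qed.

Lemma lie_top_line v : lie v (u N.-1) \in <[z]>%VS.
Proof.
have [c [w wF ->]] := flag_full b v.
rewrite lieDl lie_x_top scaler0 add0r lie_flag0 //.
by apply: (subvP (flag_le z u (leq0n N.-1))); apply: mem_flag; lia.
Qed.

(** Nondegeneracy makes [z] a multiple of the bracket of [u 0] and [u N.-1]. Both Leibniz terms stay
    in the line of [z]: any vector brackets [u N.-1] into it, and [f (u N.-1)] lies in [F 0]. *)
Lemma derivation_z (f : 'End(L)) : is_derivation f -> f z \in <[z]>%VS.
Proof.
move=> df.
have zE : z = (g N.-1)^-1 *: lie (u 0) (u N.-1).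
  by rewrite (frame_uu fr) mul1r scalerA mulVf ?scale1r // (frame_nondeg fr).
rewrite {1}zE linearZ rpredZ //= df rpredD ?lie_top_line //.
apply: lie_flag0; first by apply: mem_flag.
by apply: (subvP (flag_le z u (leq0n N.-1))); apply: derivation_u => //; lia.
Qed.

Lemma derivation_flag (f : 'End(L)) i v : is_derivation f ->
  (0 < i <= N)%N -> v \in F i -> f v \in F i.
Proof.
move=> df iN; move: v; apply: flag_ind => [|c v v' IH IH'|j jN|].
- by rewrite linear0 mem0v.
- by rewrite linearP rpredD ?rpredZ.
- by apply: (subvP (flag_le z u (_ : i <= j)%N)); [lia|apply: derivation_u; [|lia]].
- have := derivation_z df; rewrite -(flag_last z u); apply: subvP; apply: flag_le; lia.
Qed.

(* [F 0] is the centralizer of [F 1] modulo [F 3]. *)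
Lemma derivation_flag0 (f : 'End(L)) v : is_derivation f ->
  v \in F 0 -> f v \in F 0.
Proof.
move=> df; have F10 := subvP (flag_le z u (leq0n 1)).
have u1 : u 1 \in F 1 by apply: mem_flag; lia.
have fu1 : f (u 1) \in F 1 by apply: derivation_flag => //; lia.
move=> /(flag_memP (ltn_trans (isT : 0 < 3) N4)%N)[a [r rF ->]].
rewrite linearP rpredD //; last by apply: F10; apply: derivation_flag => //; lia.
apply: rpredZ; have [c [w wF fu0]] := flag_full b (f (u 0)).
(* A component [c] of [f (u 0)] along [x] would contribute [c *: u 2] to this bracket. *)
have : lie (f (u 0)) (u 1) \in <[z]>%VS.
  have -> : lie (f (u 0)) (u 1) = f (lie (u 0) (u 1)) - lie (u 0) (f (u 1)).
    by rewrite df addrK.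
  rewrite rpredB //; last by rewrite lie_flag0 ?mem_flag // F10.
  by rewrite (frame_uu fr) linearZ rpredZ //= derivation_z.
rewrite fu0 lieDl (frame_xu fr) rpredDr; last by rewrite lie_flag0 // F10.
move=> cz; rewrite /= fu0; have [c0|c0] := eqVneq c 0; first by rewrite c0 scale0r add0r.
suff : u 2 \in F 3 by rewrite (negbTE (flag_free b _)) //; lia.
rewrite -[u 2]scale1r -(mulVf c0) -scalerA rpredZ //.
by move: cz; rewrite -(flag_last z u); apply: subvP; apply: flag_le; lia.
Qed.

(* [<[x]> + F 1] is the centralizer of [F (N - 1)]. *)
Lemma derivation_xflag1 (f : 'End(L)) v : is_derivation f ->
  v \in (<[x]> + F 1)%VS -> f v \in (<[x]> + F 1)%VS.
Proof.
move=> df /memv_addP[_ /vlineP[a ->] [r rF ->]].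
rewrite linearP rpredD //; last first.
  by apply: (subvP (addvSr _ _)); apply: derivation_flag => //; lia.
apply: rpredZ; have [c [w wF fx]] := flag_full b (f x).
have [d [w' wF' wE]] := flag_memP (ltn_trans (isT : 0 < 3) N4)%N wF.
(* The second term vanishes, since [f (u N.-1)] is a combination of [u N.-1] and [z]. The first
   detects the coefficient [d] of [u 0] in [f x], multiplied by [g N.-1]. *)
have : lie (f x) (u N.-1) + lie x (f (u N.-1)) = 0.
  by rewrite -df lie_x_top linear0.
have fuN : f (u N.-1) \in F N.-1 by apply: derivation_u => //; lia.
have [] := flag_memP _ fuN; first by lia.
move=> e [r']; rewrite prednK; last by lia.
rewrite flag_last => /vlineP[k ->] ->.
rewrite linearD !linearZ /= (frame_xz fr) lie_x_top !scaler0 !addr0 fx lieDl lie_x_top.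
rewrite scaler0 add0r wE lieDl (lie_flag1_top wF') addr0 (frame_uu fr) mul1r scalerA.
move=> /eqP; rewrite scaler_eq0 (negbTE frame_z_neq0) orbF mulf_eq0.
rewrite (negbTE (frame_nondeg fr)) orbF => /eqP ->; rewrite scale0r add0r.
by rewrite memv_add // rpredZ ?memv_line.
Qed.

(** The new chain is triangular over the old one, with diagonal entries [c * a ^+ i]. Taking [v] in
    [F 1] rather than [F 0] ensures that [x'] still commutes with [u N.-1], so the chain stops at
    length [N]. *)
Lemma frame_change x' u0 (a c : K) v r :
    a != 0 -> c != 0 -> v \in F 1 -> r \in F 1 ->
    x' = a *: x + v -> u0 = c *: u 0 + r ->
  exists g', frame x' z (fun i => iter i (lie x') u0) g'.
Proof.
move=> a0 c0 vF rF x'E u0E; pose u' i := iter i (lie x') u0; rewrite -/u'.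
have F10 := subvP (flag_le z u (leq0n 1)).
have u'S i : u' i.+1 = lie x' (u' i) by [].
have u'E i : (i < N)%N ->
    exists2 ri, ri \in F i.+1 & u' i = (c * a ^+ i) *: u i + ri.
  elim: i => [|i IH] iN; first by exists r => //; rewrite expr0 mulr1.
  have [|ri riF u'i] := IH; first by lia.
  have lie_z w : w \in F 0 -> lie v w \in F i.+2.
    move=> wF; have := lie_flag0 (F10 _ vF) wF; rewrite -(flag_last z u).
    by apply: subvP; apply: flag_le; lia.
  have ri0 : ri \in F 0 by apply: subvP riF; apply: flag_le; lia.
  exists (lie x' ri + lie v ((c * a ^+ i) *: u i)).
    rewrite rpredD ?lie_z ?rpredZ //; first by apply: lie_flag => //; lia.
    by apply: (subvP (flag_le z u (leq0n i))); apply: mem_flag; lia.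
  rewrite u'S u'i lie_addr lie_scaler.
  rewrite [X in X + _](_ : _ =
    (c * a ^+ i.+1) *: u i.+1 + lie v ((c * a ^+ i) *: u i)).
    by rewrite -addrA [lie x' ri + _]addrC.
  by rewrite {1}x'E lieDl (frame_xu fr) scalerDr lie_scaler scalerA exprSr mulrA.
have cn i : c * a ^+ i != 0 by rewrite mulf_neq0 ?expf_neq0.
have u'top : exists k, u' N.-1 = (c * a ^+ N.-1) *: u N.-1 + k *: z.
  have [|ri] := u'E N.-1; first by lia.
  rewrite prednK ?flag_last; last by lia.
  by move=> /vlineP[k ->] ->; exists k.
have u'nil i : (N <= i)%N -> u' i = 0.
  move=> /subnK <-; elim: (i - N)%N => [|k IH]; last first.
    by rewrite addSn u'S IH linear0.
  rewrite add0n -{1}(prednK (_ : 0 < N)%N); last by lia.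
  rewrite u'S; have [k ->] := u'top.
  rewrite linearD !linearZ /= lie_frame_z scaler0 addr0 x'E lieDl lie_x_top.
  by rewrite (lie_flag1_top vF) scaler0 addr0 scaler0.
have b' : basis_of fullv (x' :: rcons (mkseq u' N) z).
  have /fin_all_exists[rr rrP] : forall i : 'I_N, exists ri, ri \in F i.+1 /\ u' i = (c * a ^+ i) *: u i + ri.
    by move=> i; have [ri ? ?] := u'E i (ltn_ord i); exists ri.
  apply: (triangular_basis b (c := fun i => c * a ^+ i) (r := fun i => if insub i is Some j then rr j else 0) a0 (F10 _ vF) x'E).
  by move=> i iN; rewrite insubT /=; have [? ?] := rrP (Ordinal iN).
have u'F i : u' i \in F 0.
  have [iN|/u'nil ->] := ltnP i N; last by rewrite mem0v.
  have [ri riF ->] := u'E i iN.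
  rewrite rpredD ?rpredZ //.
    by apply: (subvP (flag_le z u (leq0n i))); apply: mem_flag; lia.
  exact: (subvP (flag_le z u (leq0n i.+1))).
have u'u' i j : lie (u' i) (u' j) = (-1) ^+ i *: lie (u' 0) (u' (i + j)%N).
  (* The brackets are multiples of [z], which [x'] kills. The Leibniz rule therefore makes the form
     skew under [lie x'], and each index moved across costs a sign. *)
  elim: i j => [|i IH] j; first by rewrite scale1r.
  have := lie_leibniz x' (u' i) (u' j).
  have /vlineP[k ->] := lie_flag0 (u'F i) (u'F j).
  rewrite linearZ /= lie_frame_z scaler0 => /esym/eqP; rewrite addr_eq0 => /eqP.
  rewrite -!u'S => ->.
  by rewrite IH exprS mulN1r scaleNr addnS.
have zE s : lie (u' 0) (u' s) = coord [tuple z] 0 (lie (u' 0) (u' s)) *: z.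
  have := lie_flag0 (u'F 0) (u'F s); rewrite -span_seq1.
  by move=> /(@coord_span _ _ 1 [tuple z]); rewrite big_ord1.
exists (fun s => coord [tuple z] 0 (lie (u' 0) (u' s))); split => //.
- exact: lie_frame_z.
- by move=> i; exact: lie_frame_z.
- by move=> i j; rewrite u'u' [in LHS]zE scalerA.
(* Only the [u 0] part of [u' 0] pairs with [u N.-1], so the new value is [g N.-1] times powers of
   [a] and [c]. *)
have : lie (u' 0) (u' N.-1) != 0.
  have [k ->] := u'top.
  rewrite lie_addr !lie_scaler lie_frame_z scaler0 addr0 [u' 0]/= u0E lieDl.
  rewrite (lie_flag1_top rF) addr0 (frame_uu fr) mul1r !scalerA.
  by rewrite scaler_eq0 (negbTE frame_z_neq0) orbF !mulf_eq0 !negb_or c0 (frame_nondeg fr) expf_neq0.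
by apply: contraNneq => c1; rewrite zE c1 scale0r.
Qed.

End FrameTheory.
End Frame.

(** * The two-dimensional torus of a pure frame *)

Section PureFrame.
Variables (K : fieldType) (L : lieAlgType K) (N : nat).

(** This is the shape of [Q_n]: among the brackets of the [u i], only those with indices summing to
    [N.-1] survive. *)
Definition pure (g : nat -> K) := forall s, s != N.-1 -> g s = 0.

Section WeightDerivations.
Variables (x z : L) (u : nat -> L) (g : nat -> K).
Hypothesis fr : frame N x z u g.
Hypothesis N4 : (3 < N)%N.
Let b := frame_basis fr.

Lemma derivation_weight_u (f : 'End(L)) c d : is_derivation f ->
  f x = c *: x -> f (u 0) = d *: u 0 -> forall i, f (u i) = (d + c *+ i) *: u i.
Proof.
move=> df fx fu; elim=> [|i IH]; first by rewrite addr0.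
rewrite -(frame_xu fr) df fx IH lie_scalel lie_scaler -scalerDl.
by rewrite mulrS addrCA.
Qed.

(** Any [s] with [g s != 0] computes the weight of [z]; two distinct such values of [s] will
    constrain [c]. *)
Lemma derivation_weight_z (f : 'End(L)) c d s : is_derivation f ->
  f x = c *: x -> f (u 0) = d *: u 0 -> g s != 0 ->
  f z = (d *+ 2 + c *+ s) *: z.
Proof.
move=> df fx fu gs; have zE : z = (g s)^-1 *: lie (u 0) (u s).
  by rewrite (frame_uu fr) mul1r scalerA mulVf ?scale1r.
rewrite {1}zE linearZ /= df fu (derivation_weight_u df fx fu) lie_scalel lie_scaler.
by rewrite -scalerDl scalerA mulrC -scalerA -zE addrA -mulr2n.
Qed.

Lemma eq_on_frame (f h : 'End(L)) : f x = h x ->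
  (forall i, (i < N)%N -> f (u i) = h (u i)) -> f z = h z -> f = h.
Proof.
move=> fhx fhu fhz; apply/lfunP; apply: (frame_ind fr) => //.
  by rewrite !linear0.
by move=> a v w vE wE; rewrite !linearP /= vE wE.
Qed.

Lemma frame_basisP (v : L) : v \in x :: rcons (mkseq u N) z ->
  [\/ v = x, v = z | exists2 i, (i < N)%N & v = u i].
Proof.
rewrite inE mem_rcons inE /mkseq => /or3P[/eqP->|/eqP->|vu].
- by constructor 1.
- by constructor 2.
- by have /mapP[j] := vu; rewrite mem_iota => jN ->; constructor 3; exists j.
Qed.

Hypothesis pg : pure g.

(** Purity makes the prescribed weight of [z] consistent with every nonzero bracket of the [u i], so
    [c] and [d] are free. *)
Lemma weight_derivation c d : exists f : 'End(L), [/\ is_derivation f,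
  f x = c *: x, forall i, f (u i) = (d + c *+ i) *: u i
  & f z = (d *+ 2 + c *+ N.-1) *: z].
Proof.
have [f fE] := basis_extend
  (c *: x :: rcons (mkseq (fun i => (d + c *+ i) *: u i) N)
     ((d *+ 2 + c *+ N.-1) *: z)) b.
have fx : f x = c *: x by apply: (fE 0).
have fu i : f (u i) = (d + c *+ i) *: u i.
  have [iN|/(frame_nil fr) ->] := ltnP i N; last by rewrite linear0 scaler0.
  have := fE i.+1; rewrite /= size_rcons size_mkseq ltnS ltnW ?ltnS // => /(_ isT).
  by rewrite !nth_rcons !size_mkseq iN !nth_mkseq.
have fz : f z = (d *+ 2 + c *+ N.-1) *: z.
  have := fE N.+1; rewrite /= size_rcons size_mkseq ltnSn => /(_ isT).
  by rewrite !nth_rcons !size_mkseq ltnn eqxx.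
have ziff w : lie z w = 0 by rewrite lie_antisym (lie_frame_z fr) oppr0.
exists f; split=> //; rewrite /is_derivation.
apply: (frame_ind fr) => [w|a v v' IH IH' w|||w].
- by rewrite linear0 !lie0l linear0 addr0.
- by rewrite linearP /= !lieDl linearP /= IH IH' scalerDr addrACA.
- apply: (frame_ind fr) => [|a v v' IH IH'||j jN|].
  + by rewrite !linear0 addr0.
  + by rewrite !lieDr !linearP /= ?lieDr IH IH' scalerDr addrACA.
  + by rewrite fx lie_scalel lie_scaler liexx linear0 scaler0 addr0.
  + rewrite fx fu lie_scalel lie_scaler (frame_xu fr) fu -scalerDl.
    by rewrite mulrS addrCA.
  + by rewrite fx fz lie_scalel lie_scaler (frame_xz fr) linear0 !scaler0 addr0.
- move=> i iN; apply: (frame_ind fr) => [|a v v' IH IH'||j jN|].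
  + by rewrite !linear0 addr0.
  + by rewrite !lieDr !linearP /= ?lieDr IH IH' scalerDr addrACA.
  + rewrite fx fu lie_scalel lie_scaler lie_antisym (frame_xu fr) linearN /= fu.
    by rewrite !scalerN -opprD -scalerDl mulrSr addrA.
  + rewrite !fu lie_scalel lie_scaler (frame_uu fr) linearZ /= fz.
    have [ij|/pg ->] := eqVneq (i + j)%N N.-1; last first.
      by rewrite mulr0 !scale0r !scaler0 addr0.
    rewrite -ij !scalerA -scalerDl; congr (_ *: _).
    by rewrite mulrnDr; ring.
  + by rewrite fu fz lie_scalel lie_scaler (frame_uz fr) linear0 !scaler0 addr0.
- by rewrite fz lie_scalel !ziff linear0 scaler0 addr0.
Qed.

(** The generators [x] and [u 0] determine a derivation. Those scaling both form the span of [D] and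
    [E], whose weights on them are (1, 0) and (0, 1). *)
Lemma frame_torus : exists S : {vspace 'End(L)}, [/\ is_torus S, \dim S = 2
  & forall f : 'End(L), is_derivation f -> (exists c, f x = c *: x) ->
      (exists d, f (u 0) = d *: u 0) -> f \in S].
Proof.
have [D [dD Dx Du Dz]] := weight_derivation 1 0.
have [E [dE Ex Eu Ez]] := weight_derivation 0 1.
have comb f : f \in <<[:: D; E]>>%VS -> exists c d, f = c *: D + d *: E.
  rewrite span_cons span_seq1 => /memv_addP[_ /vlineP[c ->] [_ /vlineP[d ->] ->]].
  by exists c, d.
have combE c d v : (c *: D + d *: E) v = c *: D v + d *: E v.
  by rewrite add_lfunE !scale_lfunE.
have eig f v : f \in <<[:: D; E]>>%VS -> v \in x :: rcons (mkseq u N) z ->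
    exists a, f v = a *: v.
  move=> /comb[c [d ->]] /frame_basisP; rewrite combE.
  case=> [->|->|[i _ ->]]; rewrite ?Dx ?Ex ?Du ?Eu ?Dz ?Ez !scalerA -scalerDl.
  - by eexists.
  - by eexists.
  - by eexists.
exists <<[:: D; E]>>%VS; split.
- split=> [f /comb[c [d ->]] v w|f fS|f h fS hS].
  + rewrite !combE dD dE lie_addl lie_addr !lie_scalel !lie_scaler !scalerDr.
    by rewrite addrACA.
  + by exists (x :: rcons (mkseq u N) z); split=> // v; apply: eig.
  + have ch v : v \in x :: rcons (mkseq u N) z -> (f \o h)%VF v = (h \o f)%VF v.
      move=> vX; have [a fv] := eig _ _ fS vX; have [c hv] := eig _ _ hS vX.
      by rewrite !comp_lfunE hv fv !linearZ /= fv hv !scalerA mulrC.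
    apply: eq_on_frame => [|i iN|]; apply: ch.
    * exact: mem_head.
    * by rewrite inE mem_rcons inE map_f ?orbT // mem_iota.
    * by rewrite inE mem_rcons mem_head orbT.
- apply/eqP; change (free [:: D; E]).
  rewrite free_cons span_seq1 seq1_free; apply/andP; split.
    apply/vlineP => -[k Dk]; move: Dx; rewrite Dk scale_lfunE Ex scale0r scaler0.
    by rewrite scale1r => /esym/eqP; rewrite (negbTE (basis_x_neq0 b)).
  apply/eqP => E0; have := Eu 0; rewrite E0 lfunE /= addr0 scale1r => /esym/eqP.
  by rewrite (negbTE (basis_u_neq0 b _)) //; lia.
move=> f df [c fx] [d fu].
suff -> : f = c *: D + d *: E.
  by rewrite span_cons span_seq1 memv_add ?rpredZ ?memv_line.
have fz := derivation_weight_z df fx fu (frame_nondeg fr).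
apply: eq_on_frame => [|i iN|]; rewrite combE.
- by rewrite fx Dx Ex scale0r scaler0 addr0 scale1r.
- rewrite (derivation_weight_u df fx fu) Du Eu !scalerA -scalerDl.
  by congr (_ *: _); rewrite mul0rn addr0 add0r mulr1 mulr_natr addrC.
- rewrite fz Dz Ez !scalerA -scalerDl; congr (_ *: _).
  by rewrite !mul0rn addr0 add0r !mulr_natr addrC.
Qed.

End WeightDerivations.

(** * Inverse square roots of polynomials up to a given degree *)

Section Purification.

(** The sum runs over all coefficients of [p], not up to [t], to match the expansion of the new
    [u 0] in [frame_purify]. *)
Lemma coef_mul_sum (p q : {poly K}) t : (p * q)`_t =
  \sum_(k < size p) p`_k * (if (t < k)%N then 0 else q`_(t - k)).
Proof.
rewrite -{1}[p]coefK poly_def mulr_suml coef_sum.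
by apply: eq_bigr => k _; rewrite -scalerAl coefZ coefXnM.
Qed.

(** Up to a constant, [p] is a truncated inverse square root of [h], built one coefficient at a
    time. Adding [a *: 'X^(d.+1)] alters coefficient [d.+1] of the product by [2 * a * h_0], which
    can be solved for [a]. *)
Lemma exists_square_inverse (h : {poly K}) d : (2%:R : K) != 0 -> h`_0 != 0 ->
  exists2 p : {poly K}, p`_0 = 1 &
    forall t, (0 < t <= d)%N -> (p * (p * h))`_t = 0.
Proof.
move=> c2 h0; elim: d => [|d [p p0 pd]].
  by exists 1; [rewrite coef1 | move=> t; lia].
pose a := - (p * (p * h))`_d.+1 / (2%:R * h`_0).
pose q := a *: (2%:R * (p * h)) + 'X^(d.+1) * (a ^+ 2 *: h).
have pE : (p + a *: 'X^(d.+1)) * ((p + a *: 'X^(d.+1)) * h)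
    = p * (p * h) + 'X^(d.+1) * q.
  by rewrite /q -!mul_polyC rmorphXn /=; ring.
exists (p + a *: 'X^(d.+1)) => [|t /andP[t0 td]].
  by rewrite coefD coefZ coefXn p0 mulr0 addr0.
rewrite pE coefD coefXnM; case: ltnP => td'.
  by rewrite pd ?addr0 // t0.
have -> : t = d.+1 by lia.
rewrite subnn /q coefD coefXnM addr0 coefZ mulr_natl coefMn coef0M p0 mul1r.
by rewrite /a -mulr_natl; field; apply/andP.
Qed.

End Purification.
End PureFrame.

(** * Purification of frames and the rank *)

Section Rank.
Variables (K : fieldType) (L : lieAlgType K) (N : nat).
Hypothesis char0 : forall k, (k%:R == 0 :> K) = (k == 0)%N.
Hypothesis N4 : (3 < N)%N.

Let c2 : (2%:R : K) != 0. Proof. by rewrite char0. Qed.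

Section Purify.
Variables (x z : L) (u : nat -> L) (g : nat -> K).
Hypothesis fr : frame N x z u g.

Lemma mem_flag_le i j : (i <= j)%N -> (i <= N)%N -> u j \in flag N z u i.
Proof.
move=> ij iN; have [jN|Nj] := leqP j N.
  by apply: (subvP (flag_le N z u ij)); apply: mem_flag fr _ _.
by rewrite (frame_nil fr) ?mem0v // ltnW.
Qed.

(* Replacing [u 0] by [\sum_k p_k u_(2 k)] multiplies the generating polynomial
   [\sum_t g (N - 1 - 2 t) X^t] of the bracket by [p ^+ 2]. *)
Lemma frame_purify : exists (p : {poly K}) u' g',
  [/\ frame N x z u' g', pure N g' & u' 0%N = \sum_(k < size p) p`_k *: u (2 * k)%N].
Proof.
(* Beyond [2 * j = N.-1] the subtraction truncates, but the comparison below only reaches degrees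
   [t] with [2 * t <= N.-1]. *)
pose h := \poly_(j < N) g (N.-1 - 2 * j)%N.
have h0 : h`_0 != 0.
  by rewrite coef_poly muln0 subn0; case: ltnP => [_|]; [exact: frame_nondeg fr|lia].
have [p p0 ph] := exists_square_inverse N c2 h0.
have p_gt0 : (0 < size p)%N.
  by rewrite size_poly_gt0; apply: contra_eq_neq p0 => ->; rewrite coef0 eq_sym oner_neq0.
pose u0 := \sum_(k < size p) p`_k *: u (2 * k)%N.
have [r rF u0E] : exists2 r, r \in flag N z u 1 & u0 = 1 *: u 0%N + r.
  rewrite /u0 -(prednK p_gt0) big_ord_recl p0; eexists; last by [].
  by apply: rpred_sum => k _; rewrite rpredZ ?mem_flag_le // /bump; lia.
have xE : x = 1 *: x + 0 by rewrite scale1r addr0.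
have [g' fr'] := frame_change fr N4 (oner_neq0 K) (oner_neq0 K) (mem0v _) rF xE u0E.
set u' := fun i => iter i (lie x) u0 in fr'.
have u'E i : u' i = \sum_(k < size p) p`_k *: u (2 * k + i)%N.
  elim: i => [|i IH]; first by apply: eq_bigr => k _; rewrite addn0.
  rewrite [LHS]/= -/(u' i) IH linear_sum; apply: eq_bigr => k _ /=.
  by rewrite lie_scaler (frame_xu fr) addnS.
(* The shifts [2 * k] are even, so no signs appear. *)
have g'E s : g' s = \sum_(k < size p) p`_k * \sum_(l < size p) p`_l * g (2 * k + (2 * l + s))%N.
  have := frame_uu fr' 0 s; rewrite mul1r add0n !u'E lie_suml => gz.
  apply/eqP; rewrite -subr_eq0 -[_ == 0]orbF -(negbTE (frame_z_neq0 fr)).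
  rewrite -scaler_eq0 scalerBl -gz subr_eq0 scaler_suml; apply/eqP.
  apply: eq_bigr => k _; rewrite lie_scalel lie_sumr -scalerA scaler_suml.
  congr (_ *: _); apply: eq_bigr => l _ /=.
  by rewrite lie_scaler (frame_uu fr) scalerA addn0 exprM sqrrN !expr1n mul1r.
exists p, u', g'; split=> // s sN.
have [Ns|sN'] := leqP N s; first by rewrite (frame_g0 fr').
have [os|es] := boolP (odd s); last by rewrite (frame_g_even fr').
have oN : odd N.-1.
  by apply: contraNT (frame_nondeg fr) => /(frame_g_even fr c2)/eqP.
have [t t0 sE] : exists2 t, (0 < t <= N)%N & (N.-1 = 2 * t + s)%N.
  by exists ((N.-1 - s)./2)%N; lia.
rewrite g'E; transitivity (p * (p * h))`_t; last exact: ph.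
rewrite coef_mul_sum; apply: eq_bigr => k _; congr (_ * _).
(* For [k > t] the index exceeds [N.-1], where [g] vanishes; this matches the zero terms of the
   product. *)
case: ltnP => kt.
  by rewrite big1 // => l _; rewrite (frame_g0 fr) ?mulr0 //; lia.
rewrite coef_mul_sum; apply: eq_bigr => l _; congr (_ * _).
case: ltnP => lt; first by rewrite (frame_g0 fr) //; lia.
rewrite coef_poly ifT; last by lia.
by congr (g _); lia.
Qed.

End Purify.

Lemma torus_frame (x z : L) (u : nat -> L) (g : nat -> K) (T : {vspace 'End(L)}) :
    frame N x z u g -> is_torus T ->
  exists x' u' g', [/\ frame N x' z u' g', pure N g'
    & forall f : 'End(L), f \in T ->
        (exists c, f x' = c *: x') /\ (exists d, f (u' 0%N) = d *: u' 0%N)].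
Proof.
move=> fr [dT eT cT]; have b := frame_basis fr.
have N0 : (0 < N)%N by lia.
have [||y1 [y1F y1nF ey1]] := common_eigenvector (U := flag N z u 1) (W := flag N z u 0) eT cT.
- by move=> f y fT; apply: (derivation_flag0 fr N4 (dT f fT)).
- by apply/subvPn; exists (u 0%N); [apply: (mem_flag_le fr) | exact: (flag_free b N0)].
have [||y0 [y0F y0nF ey0]] := common_eigenvector (U := flag N z u 1) (W := (<[x]> + flag N z u 1)%VS) eT cT.
- by move=> f y fT; apply: (derivation_xflag1 fr N4 (dT f fT)).
- apply/subvPn; exists x; first exact: subvP (addvSl _ _) _ (memv_line _).
  by apply: contra (flag_x b); apply: subvP; apply: flag_le.
have [c [r rF y1E]] := flag_memP N0 y1F.
have /memv_addP[_ /vlineP[a ->] [v vF y0E]] := y0F.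
have c0 : c != 0.
  by apply: contraNneq y1nF => c0; rewrite y1E c0 scale0r add0r.
have a0 : a != 0.
  by apply: contraNneq y0nF => a0; rewrite y0E a0 scale0r add0r.
have [g' fr'] := frame_change fr N4 a0 c0 vF rF y0E y1E.
set u' := fun i => _ in fr'.
(* Either some [s < N.-1] carries a nonzero value, or the frame is already pure. *)
have [/hasP[s]|/hasPn pg] := boolP (has (fun s => g' s != 0) (iota 0 N.-1)).
  rewrite mem_iota => sN gs.
  have [p [u'' [g'' [fr'' pg'' u''0]]]] := frame_purify fr'.
  exists y0, u'', g''; split=> // f fT; split; first exact: ey0.
  have [a' fy0] := ey0 f fT; have [d fy1] := ey1 f fT.
  have df := dT f fT; exists d.
  have fz := derivation_weight_z fr' df fy0 fy1 gs.
  have := derivation_weight_z fr' df fy0 fy1 (frame_nondeg fr').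
  (* Equating the two weights of [z] gives [a' *+ (N.-1 - s) = 0], hence [a' = 0] in characteristic
     0. All the [u' i] then have the same weight [d], and so does their combination [u'' 0]. *)
  move=> /eqP; rewrite fz -subr_eq0 -scalerBl scaler_eq0.
  rewrite (negbTE (frame_z_neq0 fr)) orbF opprD addrACA subrr add0r.
  rewrite subr_eq0 eq_sym -subr_eq0 -mulrnBr; last by lia.
  rewrite -mulr_natr mulf_eq0 char0 => /orP[/eqP a'0|]; last by lia.
  rewrite u''0 linear_sum scaler_sumr; apply: eq_bigr => k _ /=.
  rewrite linearZ /= (derivation_weight_u fr' df fy0 fy1) a'0 mul0rn addr0.
  by rewrite !scalerA mulrC.
exists y0, u', g'; split=> [//|s sN|f fT]; last by split; [apply: ey0|apply: ey1].
have [sN'|Ns] := ltnP s N.-1; last by rewrite (frame_g0 fr') //; lia.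
by apply/eqP; apply: contraNT (pg s _) => //; rewrite ?negbK mem_iota.
Qed.

(** Every torus sits inside a two-dimensional one, so a maximal torus equals it. A torus of
    dimension 2 is itself maximal, which gives existence. *)
Lemma pure_frame_rank (x z : L) (u : nat -> L) (g : nat -> K) :
  frame N x z u g -> pure N g -> has_rank L 2.
Proof.
move=> fr pg.
have sub T : is_torus T -> exists S : {vspace 'End(L)},
    [/\ is_torus S, \dim S = 2 & (T <= S)%VS].
  move=> tT; have [x' [u' [g' [fr' pg' eT]]]] := torus_frame fr tT.
  have [S [tS dS inS]] := frame_torus fr' N4 pg'.
  exists S; split=> //; apply/subvP => f fT; have [ex eu] := eT f fT.
  by apply: inS => //; case: tT => dT _ _; apply: dT.
have [S [tS dS _]] := frame_torus fr N4 pg.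
split.
  exists S; split=> // T tT ST; have [S' [_ dS' TS']] := sub T tT.
  by apply/eqP; rewrite eq_sym eqEdim ST dS -dS' dimvS.
move=> T [tT mT]; have [S' [tS' dS' TS']] := sub T tT.
by rewrite -(mT S' tS' TS').
Qed.

End Rank.

(** * Isomorphism of C_n with Q_n *)

Section FrameIso.
Variables (K : fieldType) (N : nat).

(** Purity leaves a single structure constant for the brackets of the [u i]; rescaling [z] by the
    ratio of the two constants matches them. *)
Lemma pure_frame_morphism (L M : lieAlgType K) (x z : L) u g (x' z' : M) u' g' :
    frame N x z u g -> pure N g -> frame N x' z' u' g' -> pure N g' ->
  exists f : 'Hom(L, M), [/\ forall v w, f (lie v w) = lie (f v) (f w),
    f x = x', forall i, f (u i) = u' i & f z = (g' N.-1 / g N.-1) *: z'].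
Proof.
move=> fr pg fr' pg'; set k := g' _ / _.
have [f fE] := basis_extend (x' :: rcons (mkseq u' N) (k *: z')) (frame_basis fr).
have fx : f x = x' by apply: (fE 0%N).
have fu i : f (u i) = u' i.
  have [iN|Ni] := ltnP i N; last by rewrite (frame_nil fr) // (frame_nil fr') // linear0.
  have := fE i.+1; rewrite /= size_rcons size_mkseq ltnS ltnW ?ltnS // => /(_ isT).
  by rewrite !nth_rcons !size_mkseq iN !nth_mkseq.
have fz : f z = k *: z'.
  have := fE N.+1; rewrite /= size_rcons size_mkseq ltnSn => /(_ isT).
  by rewrite !nth_rcons !size_mkseq ltnn eqxx.
exists f; split=> //.
have lz w : lie z w = 0 by rewrite lie_antisym (lie_frame_z fr) oppr0.
have lz' w : lie z' w = 0 by rewrite lie_antisym (lie_frame_z fr') oppr0.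
apply: (frame_ind fr) => [w|a v v' IH IH' w|||w].
- by rewrite lie0l linear0 lie0l.
- by rewrite linearP /= !lieDl linearP /= IH IH'.
- apply: (frame_ind fr) => [|a v v' IH IH'||j jN|].
  + by rewrite !linear0.
  + by rewrite !lieDr !linearP /= ?lieDr IH IH'.
  + by rewrite !liexx linear0.
  + by rewrite (frame_xu fr) fx !fu (frame_xu fr').
  + by rewrite (frame_xz fr) fz lie_scaler fx (frame_xz fr') scaler0 linear0.
- move=> i iN; apply: (frame_ind fr) => [|a v v' IH IH'||j jN|].
  + by rewrite !linear0.
  + by rewrite !lieDr !linearP /= ?lieDr IH IH'.
  + rewrite lie_antisym [RHS]lie_antisym linearN /= (frame_xu fr) fx !fu.
    by rewrite (frame_xu fr').
  + rewrite (frame_uu fr) !fu (frame_uu fr') linearZ /= fz scalerA.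
    congr (_ *: _); have [->|ij] := eqVneq (i + j)%N N.-1.
      by rewrite -mulrA; congr (_ * _); rewrite mulrC mulfVK // (frame_nondeg fr).
    by rewrite pg // pg' // !mulr0 mul0r.
  + by rewrite (frame_uz fr) fz lie_scaler fu (frame_uz fr') scaler0 linear0.
- by rewrite lz fz lie_scalel lz' scaler0 linear0.
Qed.

Lemma pure_frame_iso (L M : lieAlgType K) (x z : L) u g (x' z' : M) u' g' :
    frame N x z u g -> pure N g -> frame N x' z' u' g' -> pure N g' ->
  lie_isomorphic L M.
Proof.
move=> fr pg fr' pg'.
have [f [fl fx fu fz]] := pure_frame_morphism fr pg fr' pg'.
have [h [_ hx hu hz]] := pure_frame_morphism fr' pg' fr pg.
have nd := frame_nondeg fr; have nd' := frame_nondeg fr'.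
exists f; split=> //; exists h.
- apply: (frame_ind fr) => [|a v w vE wE||j jN|].
  + by rewrite !linear0.
  + by rewrite !linearP /= vE wE.
  + by rewrite /= fx hx.
  + by rewrite /= fu hu.
  + rewrite /= fz linearZ /= hz scalerA mulrA mulfVK //.
    by rewrite divff // scale1r.
- apply: (frame_ind fr') => [|a v w vE wE||j jN|].
  + by rewrite !linear0.
  + by rewrite !linearP /= vE wE.
  + by rewrite /= hx fx.
  + by rewrite /= hu fu.
  + rewrite /= hz linearZ /= fz scalerA mulrA mulfVK //.
    by rewrite divff // scale1r.
Qed.

End FrameIso.

(** * The defining bases of the two algebras as frames *)

Section StandardFrames.
Variables (K : fieldType) (m : nat).
Hypothesis m3 : (3 <= m)%N.
Local Notation n := (2 * m)%N.
Local Notation N := (2 * m - 2)%N.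

Definition table_coef (s : nat -> K) (i j : nat) : K :=
  if (0 < i)%N && (0 < j)%N then (-1) ^+ i * s (i + j)%N else 0.

(** Passing from [e] to [u i = e i.+1] raises the index sum by 2 and changes the sign of
    [(-1) ^+ i], hence the form [- s k.+2]. *)
Lemma table_frame (L : lieAlgType K) (e : nat -> L) (s : nat -> K) :
    basis_of fullv (mkseq e n) ->
    (forall k, (n <= k)%N -> s k = 0) -> s (n - 1)%N != 0 ->
    (forall i j, (i < n)%N -> (j < n)%N -> lie (e i) (e j) =
      (if (i == 0)%N && (1 <= j <= n - 3)%N then e j.+1 else 0)
      - (if (j == 0)%N && (1 <= i <= n - 3)%N then e i.+1 else 0)
      + table_coef s i j *: e (n - 1)%N) ->
  frame N (e 0%N) (e (n - 1)%N) (fun i => if (i < N)%N then e i.+1 else 0)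
    (fun k => - s k.+2).
Proof.
move=> be s0 sn eE; pose u i := if (i < N)%N then e i.+1 else 0.
rewrite -/u; have eqE : mkseq e n = e 0%N :: rcons (mkseq u N) (e (n - 1)%N).
  apply: (@eq_from_nth _ 0) => [|i]; first by rewrite /= size_rcons !size_mkseq; lia.
  rewrite size_mkseq => i_n; rewrite nth_mkseq //.
  case: i i_n => [//|i] i_n /=; rewrite nth_rcons size_mkseq.
  case: ltnP => iN; first by rewrite nth_mkseq // /u iN.
  by rewrite ifT; [congr e; lia|lia].
have uE i : (i < N)%N -> u i = e i.+1 by rewrite /u => ->.
split.
- by rewrite -eqE.
- move=> i; rewrite /u; case: ltnP => iN; last by rewrite ifF ?lie0r //; lia.
  rewrite eE; [|lia|lia]; rewrite /table_coef /= scale0r addr0 subr0.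
  by congr (if _ then _ else _); lia.
- by move=> i Ni; rewrite /u ifF //; lia.
- rewrite eE; [|lia|lia]; rewrite /table_coef /= scale0r addr0.
  by rewrite ifF ?ifF ?subr0 //; lia.
- move=> i; rewrite /u; case: ltnP => iN; last by rewrite lie0l.
  rewrite eE; [|lia|lia].
  have -> : table_coef s i.+1 (n - 1) = 0.
    by rewrite /table_coef s0 ?mulr0 ?if_same //; lia.
  by rewrite /= ifF ?subr0 ?add0r ?scale0r //; lia.
- move=> i j; rewrite /u.
  case: (ltnP i N) => iN; last by rewrite lie0l s0 ?oppr0 ?mulr0 ?scale0r //; lia.
  case: (ltnP j N) => jN; last by rewrite lie0r s0 ?oppr0 ?mulr0 ?scale0r //; lia.
  rewrite eE; [|lia|lia]; rewrite /table_coef /= subrr add0r.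
  by rewrite exprS addnS addSn mulN1r mulNr mulrN.
- have -> : N.-1.+2 = (n - 1)%N by lia.
  by rewrite oppr_eq0.
Qed.

Lemma bvec_basis : basis_of fullv (mkseq (bvec K n) n).
Proof.
rewrite basisEdim size_mkseq dimvf /dim /= mul1n leqnn andbT.
apply/subvP => v _; rewrite (row_sum_delta v); apply: rpred_sum => i _.
rewrite rpredZ // [delta_mx _ _](_ : _ = bvec K n i); last first.
  by apply/rowP => j; rewrite !mxE eqxx.
by apply: memv_span; apply/mapP; exists (i : nat); rewrite // mem_iota /= add0n ltn_ord.
Qed.

Definition Q_form (k : nat) : K := - (k.+1 == n)%N%:R.

(** The ordinal [l] stands for the parameter number [l.+1], which occurs at index sum
    [n - 2 * l.+1 - 1]. *)
Definition C_form (alpha : 'I_(m - 2) -> K) (k : nat) : K :=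
  (k.+1 == n)%N%:R - \sum_(l < m - 2) (k + 2 * l.+1 + 1 == n)%N%:R * alpha l.

Lemma antidiag_form (k : nat) (c : K) (i j : nat) :
  antidiag m k c i j - antidiag m k c j i =
  table_coef (fun s => (s + 2 * k + 1 == n)%N%:R * c) i j.
Proof.
rewrite antidiagB /table_coef; case: (0 < i)%N => //=; case: (0 < j)%N => //=.
by case: (_ == _) => /=; rewrite ?mul1r ?mul0r ?mulr0.
Qed.

Lemma Q_frame : frame N (bvec K n 0 : Q_alg K m) (bvec K n (n - 1))
  (fun i => if (i < N)%N then bvec K n i.+1 else 0) (fun k => - Q_form k.+2).
Proof.
apply: (@table_frame (Q_alg K m) (bvec K n) Q_form).
- exact: bvec_basis.
- by move=> k nk; rewrite /Q_form; case: eqP; [lia|rewrite oppr0].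
- by rewrite /Q_form (_ : ((n - 1).+1 == n)%N = true) ?oppr_eq0 ?oner_eq0 //; lia.
move=> i j i_n j_n; rewrite [LHS](table_bracket_bvec _ i_n j_n).
have tE i' j' : Q_table K m i' j' =
    (if (i' == 0)%N && (1 <= j' <= n - 3)%N then bvec K n j'.+1 else 0)
    + antidiag m 0 (-1) i' j' *: bvec K n (n - 1).
  rewrite /Q_table /antidiag; congr (_ + _); rewrite !subn0 muln0 add0n subnAC.
  case: ifP => [H|_]; last by rewrite scale0r.
  by congr (_ *: _); case: i' H => // i' _; rewrite subSS subn0 exprS; ring.
rewrite !tE opprD addrACA -scalerBl antidiag_form; congr (_ + _ *: _).
rewrite /table_coef /Q_form muln0 addn0 addn1 mulrN1.
by case: ifP.
Qed.

Lemma C_frame (alpha : 'I_(m - 2) -> K) :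
  frame N (bvec K n 0 : C_alg alpha) (bvec K n (n - 1))
  (fun i => if (i < N)%N then bvec K n i.+1 else 0) (fun k => - C_form alpha k.+2).
Proof.
apply: (@table_frame (C_alg alpha) (bvec K n) (C_form alpha)).
- exact: bvec_basis.
- move=> k nk; rewrite /C_form big1 => [|l _]; case: eqP => //; try lia.
    by rewrite subr0.
  by rewrite mul0r.
- rewrite /C_form big1 => [|l _].
    by rewrite (_ : ((n - 1).+1 == n)%N = true) ?subr0 ?oner_eq0 //; lia.
  by rewrite (_ : (_ == n)%N = false) ?mul0r //; lia.
move=> i j i_n j_n; rewrite [LHS](table_bracket_bvec _ i_n j_n).
have tE i' j' : C_table alpha i' j' =
    (if (i' == 0)%N && (1 <= j' <= n - 3)%N then bvec K n j'.+1 else 0)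
    + (antidiag m 0 1 i' j' + \sum_(l < m - 2) antidiag m l.+1 (- alpha l) i' j')
      *: bvec K n (n - 1).
  rewrite /C_table -addrA scalerDl; congr (_ + (_ + _)).
    rewrite /antidiag !subn0 muln0 add0n subnAC mulr1.
    by case: ifP => [H|_]; rewrite ?scale0r.
  rewrite scaler_suml; apply: eq_bigr => l _ /=; rewrite /antidiag.
  case: ifP => [H|_]; last by rewrite scale0r.
  by congr (_ *: _); rewrite exprS; ring.
rewrite !tE opprD addrACA -scalerBl; congr (_ + _ *: _).
rewrite opprD addrACA antidiag_form -sumrB.
under eq_bigr => l _ do rewrite antidiag_form.
rewrite /table_coef; case: ifP => _; last by rewrite big1 ?addr0.
rewrite -mulr_sumr -mulrDr /C_form muln0 addn0 addn1 mulr1 -sumrN.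
by congr (_ * (_ + _)); apply: eq_bigr => l _; rewrite mulrN.
Qed.

End StandardFrames.

Theorem mainTheorem2 (R : realType) (m : nat) (hm : (3 <= m)%N)
    (alpha : 'I_(m - 2) -> R[i]) :
  [/\ lie_isomorphic (C_alg alpha) (Q_alg R[i] m),
      has_rank (C_alg alpha) 2
    & ~ has_rank (C_alg alpha) 1].
Proof.
have char0 k : (k%:R == 0 :> R[i]) = (k == 0)%N by rewrite Num.Theory.pnatr_eq0.
have N4 : (3 < 2 * m - 2)%N by lia.
have [p [u [g [fr pg _]]]] := frame_purify char0 N4 (C_frame hm alpha).
have rank2 := pure_frame_rank char0 N4 fr pg.
split=> //; last first.
  (* Rank 1 is excluded because some maximal torus exists, and its dimension is 2. *)
  move=> [_ dim1]; have [[T mT] dim2] := rank2.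
  by have := dim1 T mT; rewrite dim2.
apply: (pure_frame_iso fr pg (Q_frame _ hm)).
move=> s sN; rewrite /Q_form opprK; case: eqP => // sE.
by move: sN; rewrite (_ : s = (2 * m - 2).-1) ?eqxx //; lia.
Qed.
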